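(* Let $C_1,C_2\in\mathbb{R}^{d\times d}$ be symmetric positive definite matrices. Then $\mathbb{H}_{C_1}$ is continuously embedded in $\mathbb{H}_{C_2}$ if and only if $C_1^2\ge C_2^2$. In this case, $$\|f\|_{C_2}\le\Big(\frac{\det C_1}{\det C_2}\Big)^{1/2}\|f\|_{C_1},\qquad f\in\mathbb{H}_{C_1},$$ and $k^{C_1}\preceq\frac{\det C_1}{\det C_2}\, k^{C_2}$.
   Context: For a symmetric positive definite matrix $C\in\mathbb{R}^{d\times d}$, $k^C(x,y)=\exp[-(x-y)^\top C^{-2}(x-y)]$, $x,y\in\mathbb{R}^d$, is the Gaussian kernel, and $\mathbb{H}_C$ with norm $\|\cdot\|_C$ is the (real) reproducing kernel Hilbert space on $\mathbb{R}^d$ generated by $k^C$. For symmetric matrices, $P\ge Q$ means that $P-Q$ is positive semidefinite. A normed space $V$ is continuously embedded in a normed space $W$ if $V\subset W$ and there exists $K>0$ with $\|v\|_W\le K\|v\|_V$ for all $v\in V$. For two symmetric positive definite real-valued kernels $k_1,k_2$ on a set $X$, $k_1\preceq k_2$ means $\sum_{i,j=1}^n\alpha_i\alpha_jk_1(x_i,x_j)\le\sum_{i,j=1}^n\alpha_i\alpha_jk_2(x_i,x_j)$ for all $n\in\mathbb{N}$, $\alpha_j\in\mathbb{R}$, $x_j\in X$, $j=1,\ldots,n$. *)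

(* Defs.v *)
From HB Require Import structures.
From mathcomp Require Import all_boot all_order all_algebra.
From mathcomp Require Import all_classical all_reals all_analysis.

Set Implicit Arguments.
Unset Strict Implicit.
Unset Printing Implicit Defensive.

Import Order.TTheory GRing.Theory Num.Theory.
Import numFieldNormedType.Exports.

Local Open Scope classical_set_scope.
Local Open Scope ring_scope.

Definition spdmx (R : realType) (d : nat) (M : 'M[R]_d) : Prop :=
  M^T = M /\ forall x : 'cV[R]_d, x != 0 -> 0 < (x^T *m M *m x) 0 0.

Definition psdmx (R : realType) (d : nat) (M : 'M[R]_d) : Prop :=
  M^T = M /\ forall x : 'cV[R]_d, 0 <= (x^T *m M *m x) 0 0.

Definition loewner_ge (R : realType) (d : nat) (P Q : 'M[R]_d) : Prop :=
  psdmx (P - Q).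

Definition gauss_kernel (R : realType) (d : nat) (C : 'M[R]_d)
    (x y : 'cV[R]_d) : R :=
  expR (- ((x - y)^T *m (invmx C ^+ 2) *m (x - y)) 0 0).

Definition kernel_le (R : realType) (X : Type) (k1 k2 : X -> X -> R) : Prop :=
  forall (n : nat) (a : 'I_n -> R) (x : 'I_n -> X),
    \sum_(i < n) \sum_(j < n) a i * a j * k1 (x i) (x j) <=
    \sum_(i < n) \sum_(j < n) a i * a j * k2 (x i) (x j).

(* A real reproducing kernel Hilbert space on X with kernel k: a linear
   subspace of the functions on X, complete for the norm of an inner product,
   which contains the sections k x = k(x, .) and has the reproducing property.
   By the Moore-Aronszajn theorem the carrier, and the inner product on it, are
   determined by k; the values of rkhs_dot outside the carrier are junk. *)
Record rkhs (R : realType) (X : Type) (k : X -> X -> R) := Rkhs {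
  rkhs_set : set (X -> R^o);
  rkhs_dot : (X -> R^o) -> (X -> R^o) -> R;
  rkhs_set0 : rkhs_set (0 : X -> R^o);
  rkhs_setP : forall (a : R) (f g : X -> R^o),
    rkhs_set f -> rkhs_set g -> rkhs_set (a *: f + g);
  rkhs_dotC : forall f g : X -> R^o, rkhs_set f -> rkhs_set g ->
    rkhs_dot f g = rkhs_dot g f;
  rkhs_dotP : forall (a : R) (f g h : X -> R^o),
    rkhs_set f -> rkhs_set g -> rkhs_set h ->
    rkhs_dot (a *: f + g) h = a * rkhs_dot f h + rkhs_dot g h;
  rkhs_dot_ge0 : forall f : X -> R^o, rkhs_set f -> 0 <= rkhs_dot f f;
  rkhs_dot_eq0 : forall f : X -> R^o, rkhs_set f ->
    rkhs_dot f f = 0 -> f = 0;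
  rkhs_complete : forall u : nat -> (X -> R^o),
    (forall n, rkhs_set (u n)) ->
    (forall e : R, 0 < e -> \forall m & n \near \oo,
       Num.sqrt (rkhs_dot (u m - u n) (u m - u n)) < e) ->
    exists2 f : X -> R^o, rkhs_set f &
      Num.sqrt (rkhs_dot (u n - f) (u n - f)) @[n --> \oo] --> (0 : R);
  rkhs_kernel : forall x : X, rkhs_set (k x);
  rkhs_repr : forall (f : X -> R^o) (x : X), rkhs_set f ->
    f x = rkhs_dot f (k x)
}.

Definition rkhs_norm (R : realType) (X : Type) (k : X -> X -> R)
    (H : rkhs k) (f : X -> R^o) : R :=
  Num.sqrt (rkhs_dot H f f).

Definition continuously_embedded (R : realType) (X : Type)
    (k1 k2 : X -> X -> R) (H1 : rkhs k1) (H2 : rkhs k2) : Prop :=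
  rkhs_set H1 `<=` rkhs_set H2 /\
  exists2 K : R, 0 < K &
    forall f, rkhs_set H1 f -> rkhs_norm H2 f <= K * rkhs_norm H1 f.

(* Main.v *)
Require Import Defs.
From HB Require Import structures.
From mathcomp Require Import all_boot all_order all_algebra.
From mathcomp Require Import all_classical all_reals all_analysis.
From mathcomp Require Import ring lra zify.

Set Implicit Arguments.
Unset Strict Implicit.
Unset Printing Implicit Defensive.

Import Order.TTheory GRing.Theory Num.Theory.
Import numFieldNormedType.Exports.

Local Open Scope classical_set_scope.
Local Open Scope ring_scope.

(** * Embeddings between the reproducing kernel Hilbert spaces of Gaussian kernels

   By Aronszajn's theorem, a reproducing kernel Hilbert space H1 is
   continuously embedded in H2 exactly when k1 <= K k2 for some constant K in
   the positive definite order, the embedding then having norm at most the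
   square root of K ([kernel_le_of_embedding], [embedding_of_kernel_le]).  Two
   facts on Gaussian kernels remain.  The usual proofs compare Fourier
   transforms; the ones given here use finite sums
   and calculus in one variable.

   If C1^2 >= C2^2, then C1^2 - C2^2 is a sum of matrices w w^T
   ([psd_sum_rank1]), and it suffices to follow the kernel
   exp (- x^T A^-1 x) when A becomes A + w w^T ([gauss_gram_rank1]).  Put
   P = A^-1, u = P w and q = w^T P w.  The inverse of A + w w^T is P_t for
   t = 1 / (1 + q), where P_t = P - t u u^T, and det A is multiplied by 1 + q.
   Fix points x_i and weights a_i, and let
     T t = sum_ij a_i a_j exp (- (x_i - x_j)^T P_t (x_i - x_j)).
   Up to a nonnegative factor, the derivative of (1 - t q) T(t)^2 is the
   second derivative at h = 0 of
     h |-> sum_ij a_i a_j exp (- z^T P_t z),  z = x_i - x_j + h w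
   (this is the heat equation, in disguise).  Since a Gaussian kernel is
   positive definite, that function of h is maximal at 0, whence its second
   derivative is not positive ([gauss_second_derivative]).  So
   (1 - t q) T(t)^2 decreases, and the comparison of its values at 0 and at
   1 / (1 + q) is the claim for a single w ([gauss_gram_downdate]).

   Conversely, let k1 <= K k2.  On the line spanned by x, the two kernels are
   exp (- a (s - t)^2) and exp (- b (s - t)^2), with a = x^T C1^-2 x and
   b = x^T C2^-2 x.  Testing the inequality on divided differences of order n
   with a step that tends to 0 compares the derivatives of order 2n at 0, and
   gives a^n <= K b^n.  This holds for all n, so a <= b whatever K is
   ([gauss1_kernel_le]).  Hence C1^-2 <= C2^-2, and inversion reverses the
   order ([spd_inv_antitone]). *)

(** * The exponential and its expansion at 0 *)

Lemma sum_exp_coeff_le (R : realType) (x : R) (n : nat) : 0 <= x ->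
  \sum_(0 <= k < n) x ^+ k / k`!%:R <= expR x.
Proof.
move=> x0.
have := @nondecreasing_cvgn_le R (series (exp_coeff x)) _ (is_cvg_series_exp_coeff x) n.
apply; apply/nondecreasing_seqP => m.
by rewrite /series /= big_nat_recr//= lerDl exp_coeff_ge0.
Qed.

(** The bound lacks the usual factor 1 / n`!; only the order of vanishing of the
   remainder at 0 matters below. *)
Lemma expR_taylor (R : realType) (n : nat) (x : R) :
  `|expR x - \sum_(k < n) x ^+ k / k`!%:R| <= expR `|x| * `|x| ^+ n.
Proof.
have cx : series (exp_coeff x) @ \oo --> expR x by exact: is_cvg_series_exp_coeff.
have c1 : (fun m => `|series (exp_coeff x) (n + m)%N - \sum_(k < n) x ^+ k / k`!%:R|)
   @ \oo --> `|expR x - \sum_(k < n) x ^+ k / k`!%:R|.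
  apply: cvg_norm; apply: cvgB; last exact: cvg_cst.
  have := cx; rewrite -(cvg_shiftn n); apply: cvg_trans.
  by under eq_fun do rewrite addnC.
rewrite -(cvg_lim (@Rhausdorff R) c1); apply: limr_le; first by apply/cvg_ex; eexists; exact: c1.
near=> m.
rewrite /series /= (@big_cat_nat _ _ _ n)//= ?leq_addr// big_mkord.
rewrite addrAC subrr add0r.
rewrite -{1}[n]add0n big_addn addKn.
apply: le_trans (ler_norm_sum _ _ _) _.
rewrite mulrC.
apply: le_trans (_ : `|x| ^+ n * \sum_(0 <= k < m) `|x| ^+ k / k`!%:R <= _);
    last first.
  by rewrite ler_wpM2l ?exprn_ge0// sum_exp_coeff_le.
rewrite mulr_sumr; apply: ler_sum => k _.
rewrite /exp_coeff /= normrM normfV normrX normr_nat exprD mulrA.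
rewrite [_ ^+ k * _]mulrC -!mulrA ler_wpM2l ?exprn_ge0// ler_wpM2l ?exprn_ge0//.
rewrite lef_pV2 ?posrE ?ltr0n ?fact_gt0// ler_nat.
by apply: leq_fact; rewrite leq_addr.
Unshelve. all: by end_near.
Qed.

(** Compares leading coefficients: dividing an inequality between two expansions
   by the leading power of [t] leaves [c <= M * t]. *)
Lemma le0_of_le_linear (R : realFieldType) (c M : R) :
  (forall t, 0 < t -> t <= 1 -> c <= M * t) -> c <= 0.
Proof.
move=> h; rewrite leNgt; apply/negP => c0.
have N0 : 0 < `|M| + c by rewrite ltr_wpDl.
have t0 : 0 < c / (`|M| + c) / 2 by rewrite !divr_gt0.
have t1 : c / (`|M| + c) / 2 <= 1.
  by rewrite -mulrA -invfM ler_pdivrMr ?mulr_gt0// mul1r; have := normr_ge0 M; lra.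
have := h _ t0 t1; rewrite leNgt => /negP; apply.
apply: le_lt_trans (_ : `|M| * (c / (`|M| + c) / 2) < _).
  by rewrite ler_wpM2r ?ler_norm// ltW.
have -> : `|M| * (c / (`|M| + c) / 2) = c * (`|M| / (2 * (`|M| + c))).
  by field; rewrite gt_eqF.
by rewrite gtr_pMr// ltr_pdivrMr ?mulr_gt0// mul1r; have := normr_ge0 M; lra.
Qed.

(** A kernel given by finitely many features may be absorbed into the weights,
   one feature at a time; this is the case of Schur's product theorem that the
   exponential series needs. *)
Lemma psd_sum_exprn (R : realType) (I : Type) (r : seq I) (m : nat)
    (f : 'I_m -> I -> R) (n : nat) (c : I -> R) :
  0 <= \sum_(i <- r) \sum_(j <- r) c i * c j * (\sum_l f l i * f l j) ^+ n.
Proof.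
elim: n c => [|n IH] c.
  under eq_bigr do under eq_bigr do rewrite expr0 mulr1.
  by under eq_bigr do rewrite -mulr_sumr; rewrite -mulr_suml -expr2 sqr_ge0.
under eq_bigr do under eq_bigr do rewrite exprS mulrA mulr_sumr mulr_suml.
under eq_bigr do rewrite exchange_big /=.
rewrite exchange_big /=; apply: sumr_ge0 => l _.
apply: le_trans (IH (fun i => c i * f l i)) _.
apply: ler_sum => i _; apply: ler_sum => j _.
by rewrite le_eqVlt; apply/orP; left; apply/eqP; ring.
Qed.

(** The exponential of a kernel with finitely many features is positive
   definite, being a limit of nonnegative combinations of powers. *)
Lemma psd_expR (R : realType) (I : Type) (r : seq I) (m : nat)
    (f : 'I_m -> I -> R) (c : I -> R) :
  0 <= \sum_(i <- r) \sum_(j <- r) c i * c j * expR (\sum_l f l i * f l j).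
Proof.
pose K i j := \sum_l f l i * f l j.
have cv : (fun n => \sum_(i <- r) \sum_(j <- r) c i * c j * series (exp_coeff (K i j)) n)
   @ \oo --> \sum_(i <- r) \sum_(j <- r) c i * c j * expR (K i j).
  apply: cvg_big => [|i _]; first exact: add_continuous.
  apply: cvg_big => [|j _]; first exact: add_continuous.
  apply: cvgM; first exact: cvg_cst.
  exact: is_cvg_series_exp_coeff.
rewrite -(cvg_lim (@Rhausdorff R) cv); apply: limr_ge; first by apply/cvg_ex; eexists; exact: cv.
near=> n.
rewrite /series /=.
under eq_bigr do under eq_bigr do rewrite mulr_sumr.
under eq_bigr do rewrite exchange_big /=.
rewrite exchange_big /=; apply: sumr_ge0 => k _.
rewrite /exp_coeff /=.
under eq_bigr do under eq_bigr do rewrite mulrA.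
under eq_bigr do rewrite -mulr_suml.
by rewrite -mulr_suml divr_ge0 ?psd_sum_exprn.
Unshelve. all: by end_near.
Qed.

(** When the first [n] moments of the weights [c] at the nodes [z] vanish, the
   exponential sum is equivalent to its term of order [n] as [t] tends to 0. *)
Lemma sum_expR_asymp (R : realType) (I : Type) (r : seq I) (c z : I -> R) (n : nat) :
  (forall m, (m < n)%N -> \sum_(i <- r) c i * z i ^+ m = 0) ->
  exists M : R, forall t, 0 < t -> t <= 1 ->
    `|(\sum_(i <- r) c i * expR (t * z i)) / t ^+ n
      - (\sum_(i <- r) c i * z i ^+ n) / n`!%:R| <= M * t.
Proof.
move=> h0; exists (\sum_(i <- r) `|c i| * (expR `|z i| * `|z i| ^+ n.+1)) => t t0 t1.
have tn0 : t ^+ n != 0 by rewrite expf_neq0// gt_eqF.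
have -> : (\sum_(i <- r) c i * expR (t * z i)) / t ^+ n
      - (\sum_(i <- r) c i * z i ^+ n) / n`!%:R
   = (\sum_(i <- r) c i * (expR (t * z i) - \sum_(k < n.+1) (t * z i) ^+ k / k`!%:R)) / t ^+ n.
  under [in RHS]eq_bigr do rewrite mulrBr.
  rewrite sumrB [in RHS]mulrBl; congr (_ - _).
  apply: esym; under eq_bigr do rewrite mulr_sumr.
  rewrite exchange_big /= big_ord_recr /= big1 ?add0r => [|k _].
    rewrite !mulr_suml; apply: eq_bigr => i _; rewrite exprMn; field.
    by rewrite ?tn0 pnatr_eq0 -lt0n fact_gt0 ?tn0.
  under eq_bigr => i _ do rewrite exprMn -!mulrA mulrCA.
  by rewrite -mulr_sumr; under eq_bigr do rewrite mulrA; rewrite -mulr_suml h0// mul0r mulr0.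
rewrite normrM normfV (ger0_norm (exprn_ge0 _ (ltW t0))) ler_pdivrMr ?exprn_gt0//.
rewrite -mulrA -exprS mulr_suml; apply: le_trans (ler_norm_sum _ _ _) _.
apply: ler_sum => i _; rewrite normrM -mulrA ler_wpM2l//.
apply: le_trans (expR_taylor _ _) _.
rewrite normrM (gtr0_norm t0) exprMn [in leRHS]mulrAC -[in leRHS]mulrA.
apply: ler_pM; rewrite ?expR_ge0 ?ler_expR ?mulr_ge0 ?exprn_ge0 ?(ltW t0)//.
by rewrite -[leRHS]mul1r ler_wpM2r.
Qed.

(** * Comparison of Gaussian kernels on a line *)

(** Vandermonde matrices are invertible, so that some weights on the nodes
   0, ..., n annihilate the monomials of degree less than [n] without
   annihilating the one of degree [n]. *)
Lemma divided_difference (R : realFieldType) (n : nat) :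
  exists a : 'I_n.+1 -> R, forall m, (m <= n)%N ->
    \sum_i a i * (i%:R) ^+ m = (m == n)%:R.
Proof.
pose V := Vandermonde n.+1 (\row_(j < n.+1) (j%:R : R)).
have uV : V \in unitmx.
  rewrite unitmxE unitfE det_Vandermonde.
  apply/prodf_neq0 => i _; apply/prodf_neq0 => j ij.
  by rewrite !mxE subr_eq0 eqr_nat neq_ltn ij orbT.
exists (fun i => (invmx V *m delta_mx ord_max 0 : 'cV_n.+1) i 0) => m mn.
have := mulKVmx uV (delta_mx ord_max 0 : 'cV[R]_n.+1).
move/matrixP => /(_ (Ordinal (mn : (m < n.+1)%N)) 0).
rewrite mxE !mxE eqxx andbT -val_eqE /= => <-.
by apply: eq_bigr => i _; rewrite !mxE mulrC.
Qed.

Lemma moment_diff (R : realFieldType) (n : nat) (a y : 'I_n.+1 -> R) (N : nat) :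
  \sum_i \sum_j a i * a j * (y i - y j) ^+ N =
  \sum_(l < N.+1) (-1) ^+ l * 'C(N, l)%:R *
     ((\sum_i a i * y i ^+ (N - l)) * (\sum_i a i * y i ^+ l)).
Proof.
under eq_bigr do under eq_bigr do rewrite exprBn mulr_sumr.
under eq_bigr do rewrite exchange_big /=.
rewrite exchange_big /=; apply: eq_bigr => l _.
rewrite mulr_suml mulr_sumr; apply: eq_bigr => i _.
rewrite !mulr_sumr; apply: eq_bigr => j _.
by rewrite -mulr_natr; ring.
Qed.

(** In the binomial expansion of (i - j)^(2m), every term has degree less than [n]
   in [i] or in [j], except the middle one when m = n. *)
Lemma moment_divided_difference (R : realFieldType) (n : nat) (a : 'I_n.+1 -> R) (m : nat) :
  (forall m, (m <= n)%N -> \sum_i a i * (i%:R) ^+ m = (m == n)%:R) ->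
  (m <= n)%N ->
  \sum_i \sum_j a i * a j * (i%:R - j%:R) ^+ m.*2 =
  (m == n)%:R * ((-1) ^+ n * 'C(n.*2, n)%:R).
Proof.
move=> ha mn; rewrite (moment_diff a (fun i => i%:R)).
have z (l : nat) : (l <= m.*2)%N -> ~~ [&& m == n & l == n] ->
    (\sum_i a i * i%:R ^+ (m.*2 - l)) * (\sum_i a i * i%:R ^+ l) = 0 :> R.
  move=> lm h; have [ln|nl] := ltnP l n.
    by rewrite [X in _ * X]ha ?(ltnW ln)// (ltn_eqF ln) mulr0.
  have hh : (m.*2 - l <= n)%N by lia.
  have hn : (m.*2 - l == n)%N = false by lia.
  by rewrite [X in X * _]ha// hn mul0r.
have [mEn|mDn] := eqVneq m n; last first.
  by rewrite mul0r big1// => l _; rewrite (z l) ?mulr0 ?(negbTE mDn)//; rewrite -ltnS ltn_ord.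
have hn : (n < m.*2.+1)%N by rewrite mEn; lia.
(* only the middle term l = n survives *)
rewrite (bigD1 (Ordinal hn))//= [X in _ + X]big1 ?addr0 => [|l /negbTE ln].
  by rewrite mEn -addnn addnK !ha// eqxx !(mul1r, mulr1).
rewrite (z l) ?mulr0//; first by rewrite -ltnS ltn_ord.
by move: ln; rewrite -val_eqE /= => ->; rewrite andbF.
Qed.

Lemma le_of_expr_le (R : realType) (a b K : R) : 0 <= b ->
  (forall n, a ^+ n <= K * b ^+ n) -> a <= b.
Proof.
move=> b0 h; rewrite leNgt; apply/negP => ba.
have a0 : 0 < a by rewrite (le_lt_trans b0).
have q1 : `|b / a| < 1 by rewrite ger0_norm ?divr_ge0 ?(ltW a0)// ltr_pdivrMr// mul1r.
have cv : (fun n => K * (b / a) ^+ n) @ \oo --> K * 0.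
  by apply: cvgM; [exact: cvg_cst|exact: cvg_expr].
have : 1 <= K * 0.
  rewrite -(cvg_lim (@Rhausdorff R) cv); apply: limr_ge; first by apply/cvg_ex; eexists; exact: cv.
  near=> n; rewrite expr_div_n mulrA ler_pdivlMr ?exprn_gt0// mul1r; exact: h.
by rewrite mulr0 ler10.
Unshelve. all: by end_near.
Qed.

(** The points are the multiples of a small step and the weights those of
   [divided_difference].  Both sides are then of order 2n in the step, with
   coefficients proportional to a^n and K b^n. *)
Lemma gauss1_kernel_le (R : realType) (a b K : R) : 0 <= b ->
  kernel_le (fun x y : R => expR (- (a * (x - y) ^+ 2)))
            (fun x y : R => K * expR (- (b * (x - y) ^+ 2))) ->
  a <= b.
Proof.
move=> b0 h; apply: (@le_of_expr_le _ _ _ K) => // n.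
have [c hc] := @divided_difference R n.
pose w (p : 'I_n.+1 * 'I_n.+1) : R := c p.1 * c p.2.
pose z (e : R) (p : 'I_n.+1 * 'I_n.+1) : R := - (e * (p.1%:R - p.2%:R) ^+ 2).
have mom e m : (m <= n)%N ->
    \sum_p w p * z e p ^+ m = (m == n)%:R * (e ^+ n * 'C(n.*2, n)%:R).
  move=> mn.
  transitivity ((- e) ^+ m * \sum_i \sum_j c i * c j * (i%:R - j%:R) ^+ m.*2).
    rewrite pair_big /= mulr_sumr; apply: eq_bigr => p _.
    by rewrite /w /z -mulNr exprMn -exprM mul2n; ring.
  rewrite moment_divided_difference//; have [->|] := eqVneq m n; last by rewrite !mul0r mulr0.
  by rewrite !mul1r mulrA -exprMn mulrN1 opprK.
have mom0 e m : (m < n)%N -> \sum_p w p * z e p ^+ m = 0.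
  by move=> mn; rewrite mom ?(ltnW mn)// (ltn_eqF mn) mul0r.
have [Ma hMa] := sum_expR_asymp (mom0 a).
have [Mb hMb] := sum_expR_asymp (mom0 b).
rewrite !mom// eqxx !mul1r in hMa hMb.
set g : R := 'C(n.*2, n)%:R / n`!%:R.
have g0 : 0 < g by rewrite divr_gt0 ?ltr0n ?fact_gt0// bin_gt0; lia.
suff : (a ^+ n - K * b ^+ n) * g <= 0 by rewrite pmulr_lle0// subr_le0.
apply: (@le0_of_le_linear _ _ (Ma + `|K| * Mb)) => t t0 t1.
(* the step is sqrt t, so that the exponents are linear in t *)
have := h n.+1 c (fun i => Num.sqrt t * i%:R).
rewrite !pair_big /=.
have E e (p : 'I_n.+1 * 'I_n.+1) :
    - (e * (Num.sqrt t * p.1%:R - Num.sqrt t * p.2%:R) ^+ 2) = t * z e p.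
  by rewrite -mulrBr exprMn sqr_sqrtr ?(ltW t0)// /z; ring.
under eq_bigr do rewrite E.
under [leRHS]eq_bigr do rewrite E mulrCA.
rewrite -mulr_sumr -!/(w _).
have tn : 0 < t ^+ n by rewrite exprn_gt0.
rewrite -(ler_pM2r (_ : 0 < (t ^+ n)^-1)) ?invr_gt0// -mulrA => hab.
have := hMa t t0 t1; have := hMb t t0 t1.
set A := (\sum_i _) / _ in hab *; set B := (\sum_i _) / _ in hab *.
rewrite -!mulrA -/g => hB hA.
have h1 : a ^+ n * g <= A + Ma * t.
  by move: hA; rewrite ler_norml => /andP[+ _]; lra.
have h2 : K * (B - b ^+ n * g) <= `|K| * (Mb * t).
  by apply: le_trans (ler_norm _) _; rewrite normrM ler_wpM2l.
lra.
Qed.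

(** * Reproducing kernel Hilbert spaces and the order of kernels *)

(** Weighted points are kept in lists rather than indexed by ordinals, so that
   two families can be concatenated. *)
Definition gram (R : realType) (X : Type) (k : X -> X -> R) (s : seq (R * X)) : R :=
  \sum_(p <- s) \sum_(q <- s) p.1 * q.1 * k p.2 q.2.

Definition comb (R : realType) (X : Type) (k : X -> X -> R) (s : seq (R * X))
    : X -> R^o :=
  \sum_(p <- s) p.1 *: (k p.2 : X -> R^o).

Lemma kernel_leP (R : realType) (X : Type) (k1 k2 : X -> X -> R) :
  kernel_le k1 k2 <-> forall s, gram k1 s <= gram k2 s.
Proof.
split=> [h s|h n a x].
  rewrite /gram big_tnth [leRHS]big_tnth.
  under eq_bigr do rewrite big_tnth.
  under [leRHS]eq_bigr do rewrite big_tnth.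
  exact: (h (size s) (fun i => (tnth (in_tuple s) i).1)
    (fun i => (tnth (in_tuple s) i).2)).
have := h [seq (a i, x i) | i <- index_enum 'I_n].
rewrite /gram !big_map.
under eq_bigr do rewrite big_map /=.
by under [leRHS]eq_bigr do rewrite big_map /=.
Qed.

Lemma gramZ (R : realType) (X : Type) (k : X -> X -> R) (c : R) (s : seq (R * X)) :
  gram (fun x y => c * k x y) s = c * gram k s.
Proof.
rewrite /gram mulr_sumr; apply: eq_bigr => p _.
by rewrite mulr_sumr; apply: eq_bigr => q _; rewrite mulrCA.
Qed.

(** Both the Cauchy-Schwarz inequality and the Euler equation of a minimisation
   problem come from this fact. *)
Lemma discriminant_le0 (R : realFieldType) (a b c : R) : 0 <= c ->
  (forall t, 0 <= a + 2 * t * b + t ^+ 2 * c) -> b ^+ 2 <= a * c.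
Proof.
rewrite le_eqVlt => /orP[/eqP<-|c0] h.
  have [->|b0] := eqVneq b 0; first by rewrite expr0n /= mulr0.
  (* when b != 0, the affine function of t takes the value - 1 here *)
  have := h (- (a + 1) / (2 * b)).
  have -> : a + 2 * (- (a + 1) / (2 * b)) * b + (- (a + 1) / (2 * b)) ^+ 2 * 0 = -1.
    by field.
  by rewrite ler0N1.
have := h (- b / c).
have -> : a + 2 * (- b / c) * b + (- b / c) ^+ 2 * c = (a * c - b ^+ 2) / c.
  by field; rewrite gt_eqF.
by rewrite pmulr_lge0 ?invr_gt0// subr_ge0.
Qed.

Section rkhs_theory.
Context (R : realType) (X : Type) (k : X -> X -> R) (H : rkhs k).
Implicit Types (f g h : X -> R^o) (s : seq (R * X)).
Local Notation S := (rkhs_set H).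
Local Notation dot := (rkhs_dot H).

Lemma rkhs_setZ a f : S f -> S (a *: f).
Proof. by move=> Sf; have := rkhs_setP a Sf (rkhs_set0 H); rewrite addr0. Qed.

Lemma rkhs_setB f g : S f -> S g -> S (f - g).
Proof. by move=> Sf Sg; rewrite addrC -scaleN1r; exact: rkhs_setP. Qed.

Lemma rkhs_set_comb s : S (comb k s).
Proof.
elim: s => [|p s IH]; first by rewrite /comb big_nil; exact: rkhs_set0.
by rewrite /comb big_cons; apply: rkhs_setP => //; exact: rkhs_kernel.
Qed.

Lemma rkhs_dotDl f g h : S f -> S g -> S h -> dot (f + g) h = dot f h + dot g h.
Proof. by move=> *; have := @rkhs_dotP _ _ _ H 1 f g h; rewrite scale1r mul1r; apply. Qed.

Lemma rkhs_dot0l h : S h -> dot 0 h = 0.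
Proof.
move=> Sh; have := rkhs_dotDl (rkhs_set0 H) (rkhs_set0 H) Sh.
by rewrite addr0 => /eqP; rewrite -subr_eq0 opprD addNKr oppr_eq0 => /eqP.
Qed.

Lemma rkhs_dotZl a f h : S f -> S h -> dot (a *: f) h = a * dot f h.
Proof.
move=> Sf Sh; have := rkhs_dotP a Sf (rkhs_set0 H) Sh.
by rewrite addr0 rkhs_dot0l// addr0.
Qed.

Lemma rkhs_dotZr a f h : S f -> S h -> dot f (a *: h) = a * dot f h.
Proof.
move=> Sf Sh; rewrite rkhs_dotC//; last exact: rkhs_setZ.
by rewrite rkhs_dotZl// rkhs_dotC.
Qed.

Lemma rkhs_dot_sqrDZ a f g : S f -> S g ->
  dot (a *: f + g) (a *: f + g) = a ^+ 2 * dot f f + 2 * a * dot f g + dot g g.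
Proof.
move=> Sf Sg; have Sfg := rkhs_setP a Sf Sg.
rewrite [LHS]rkhs_dotP// !(rkhs_dotC _ Sfg)//.
by rewrite ![dot (_ + _) _]rkhs_dotP// [dot g f]rkhs_dotC//; ring.
Qed.

Lemma rkhs_dot_sqrB f g : S f -> S g ->
  dot (f - g) (f - g) = dot f f - 2 * dot f g + dot g g.
Proof.
by move=> Sf Sg; rewrite addrC -scaleN1r rkhs_dot_sqrDZ// [dot g f]rkhs_dotC//; ring.
Qed.

Lemma rkhs_cauchy_schwarz f g : S f -> S g -> dot f g ^+ 2 <= dot f f * dot g g.
Proof.
move=> Sf Sg; rewrite mulrC; apply: discriminant_le0 => [|t]; first exact: rkhs_dot_ge0.
have := rkhs_dot_ge0 (rkhs_setP t Sf Sg).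
rewrite rkhs_dot_sqrDZ//; lra.
Qed.

Lemma rkhs_normE f : S f -> rkhs_norm H f ^+ 2 = dot f f.
Proof. by move=> Sf; rewrite sqr_sqrtr//; exact: rkhs_dot_ge0. Qed.

Lemma rkhs_dot_comb f s : S f -> dot f (comb k s) = \sum_(p <- s) p.1 * f p.2.
Proof.
move=> Sf; rewrite rkhs_dotC//; last exact: rkhs_set_comb.
elim: s => [|p s IH]; first by rewrite /comb !big_nil rkhs_dot0l.
rewrite /comb !big_cons rkhs_dotP//; last exact: rkhs_set_comb.
- by rewrite (rkhs_dotC (rkhs_kernel H _) Sf) -rkhs_repr// IH.
- exact: rkhs_kernel.
Qed.

Lemma comb_eval s x : comb k s x = \sum_(p <- s) p.1 * k p.2 x.
Proof.
by rewrite /comb; elim: s => [|p s IH]; rewrite ?big_nil// !big_cons -IH.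
Qed.

Lemma rkhs_kernelC x y : k x y = k y x.
Proof.
have Sk := rkhs_kernel H.
by rewrite [LHS](rkhs_repr y (Sk x)) rkhs_dotC// -(rkhs_repr x (Sk y)).
Qed.

Lemma rkhs_gram s : dot (comb k s) (comb k s) = gram k s.
Proof.
rewrite rkhs_dot_comb; last exact: rkhs_set_comb.
apply: eq_bigr => p _; rewrite comb_eval mulr_sumr; apply: eq_bigr => q _.
by rewrite mulrA rkhs_kernelC.
Qed.

(** By the hypothesis, sending k(x, .) to f x defines a bounded linear form L on
   the span of the sections of [k], and a representative of L is a function
   of the space that agrees with [f] at every point.  The representative is the
   limit of a minimising sequence of |g|^2 - 2 L g, a functional bounded below
   by - B^2; the parallelogram identity makes the sequence Cauchy.  Working
   with lists of weighted points instead of elements of the span avoids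
   checking that L is well defined. *)
Lemma rkhs_mem_of_bound f (B : R) : 0 <= B ->
  (forall s, (\sum_(p <- s) p.1 * f p.2) ^+ 2 <= B ^+ 2 * gram k s) ->
  S f /\ rkhs_norm H f <= B.
Proof.
move=> B0 hB.
pose L s := \sum_(p <- s) p.1 * f p.2.
pose J s := dot (comb k s) (comb k s) - 2 * L s.
have Sc := rkhs_set_comb.
have JB s : - B ^+ 2 <= J s.
  have := hB s; rewrite -/(L s) -rkhs_gram /J.
  have := rkhs_dot_ge0 (Sc s); set G := dot _ _ => G0 LG.
  rewrite -subr_ge0 opprK leNgt; apply/negP => hn.
  have : (G + B ^+ 2) ^+ 2 < (2 * L s) ^+ 2.
    by rewrite ltr_pXn2r ?nnegrE ?addr_ge0 ?sqr_ge0//; have := sqr_ge0 B; lra.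
  rewrite ltNge => /negP; apply; have := sqr_ge0 (G - B ^+ 2); nra.
pose E := [set J s | s in setT].
have lE : has_lbound E by exists (- B ^+ 2) => _ [s _ <-].
have E0 : E !=set0 by exists (J [::]), [::].
have mJ s : inf E <= J s by apply: ge_inf => //; exists s.
have /choice[s hs] : forall n, exists s, J s < inf E + harmonic n.
  by move=> n; have [_ [s _ <-] ?] := inf_adherent (harmonic_gt0 n) (conj E0 lE); exists s.
set m := inf E in mJ hs.
pose u n := comb k (s n).
pose cat2 a s t := [seq (a * p.1, p.2) | p <- s] ++ t : seq (R * X).
have catC a s1 s2 : comb k (cat2 a s1 s2) = a *: comb k s1 + comb k s2.
  rewrite /comb big_cat big_map scaler_sumr; congr (_ + _).
  by apply: eq_bigr => p _; rewrite scalerA.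
have catL a s1 s2 : L (cat2 a s1 s2) = a * L s1 + L s2.
  rewrite /L big_cat big_map mulr_sumr; congr (_ + _).
  by apply: eq_bigr => p _; rewrite mulrA.
(* parallelogram identity, with the bound m at the midpoint *)
have par i j : dot (u i - u j) (u i - u j) <= 2 * (harmonic i + harmonic j).
  have := mJ (cat2 (2^-1) (s i) (cat2 2^-1 (s j) [::])).
  have c0 : comb k [::] = 0 by rewrite /comb big_nil.
  have L0 : L [::] = 0 by rewrite /L big_nil.
  rewrite /J !catC !catL c0 L0 !addr0 rkhs_dot_sqrDZ//; last exact: rkhs_setZ.
  rewrite [dot (_ *: _) (_ *: _)]rkhs_dotZl//; last exact: rkhs_setZ.
  rewrite !rkhs_dotZr//.
  rewrite rkhs_dot_sqrB; [|exact: Sc..].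
  have := hs i; have := hs j; rewrite /J /u; lra.
have [] := @rkhs_complete _ _ _ H u (fun n => Sc _).
  move=> e e0.
  have e1 : 0 < e ^+ 2 / 4 by rewrite divr_gt0 ?exprn_gt0.
  near=> i j.
  have hi : harmonic i < e ^+ 2 / 4.
    by near: i; exact: (near_infty_natSinv_lt (PosNum e1)).
  have hj : harmonic j < e ^+ 2 / 4.
    by near: j; exact: (near_infty_natSinv_lt (PosNum e1)).
  rewrite -[ltRHS](gtr0_norm e0) -sqrtr_sqr ltr_sqrt ?exprn_gt0//.
  by apply: le_lt_trans (par i j) _; move: hi hj; set x := harmonic i; set y := harmonic j; lra.
move=> h Sh cvh.
have inv0 : @harmonic R @ \oo --> (0 : R) by exact: cvg_harmonic.
have sqh : (fun n => dot (u n - h) (u n - h)) @ \oo --> (0 : R).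
  have -> : (fun n => dot (u n - h) (u n - h)) =
      (fun n => Num.sqrt (dot (u n - h) (u n - h)) * Num.sqrt (dot (u n - h) (u n - h))).
    apply/funext => n; rewrite -expr2 sqr_sqrtr//.
    by apply: rkhs_dot_ge0; apply: rkhs_setB => //; exact: Sc.
  by rewrite -[X in _ --> X](mulr0 (0 : R)); exact: cvgM.
have hf : h = f.
  apply/funext => x.
  have Skx : S (k x) by exact: rkhs_kernel.
  have kx0 : 0 <= k x x by rewrite (rkhs_repr x Skx) rkhs_dot_ge0.
  suff : (h x - f x) ^+ 2 <= 0.
    by move=> hh; apply/eqP; rewrite -subr_eq0 -sqrf_eq0 eq_le hh sqr_ge0.
  have cv0 : (fun n => 2 * k x x * (dot (u n - h) (u n - h) + harmonic n)) @ \oo -->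
     2 * k x x * (0 + 0).
    by apply: cvgM; [exact: cvg_cst|exact: cvgD].
  rewrite addr0 mulr0 in cv0.
  rewrite -(cvg_lim (@Rhausdorff R) cv0); apply: limr_ge.
    by apply/cvg_ex; eexists; exact: cv0.
  near=> n.
  (* u n is almost minimal, and so almost stationary in the direction k x *)
  have h1 : (u n x - f x) ^+ 2 <= harmonic n * k x x.
    apply: discriminant_le0 => // t.
    have := mJ (cat2 1 (s n) [:: (t, x)]); rewrite /J catC catL.
    have -> : comb k [:: (t, x)] = t *: (k x : X -> R^o) by rewrite /comb big_seq1.
    have -> : L [:: (t, x)] = t * f x by rewrite /L big_seq1.
    have Stk := rkhs_setZ t Skx.
    rewrite rkhs_dot_sqrDZ//.
    rewrite [dot (t *: _) (t *: _)]rkhs_dotZl//.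
    rewrite !rkhs_dotZr//.
    rewrite -!(rkhs_repr x)//.
    have := hs n; rewrite /J /u; lra.
  have h2 : (u n x - h x) ^+ 2 <= dot (u n - h) (u n - h) * k x x.
    have Sun : S (u n - h) by apply: rkhs_setB => //; exact: Sc.
    have := rkhs_cauchy_schwarz Sun Skx.
    by rewrite -!(rkhs_repr x).
  have aux (U F V p q e : R) : (U - F) ^+ 2 <= e * p -> (U - V) ^+ 2 <= q * p ->
      (V - F) ^+ 2 <= 2 * p * (q + e).
    by have := sqr_ge0 (U - F + (U - V)); lra.
  exact: aux h1 h2.
rewrite -hf; split=> //; rewrite -(ler_pXn2r (isT : (0 < 2)%N)) ?nnegrE ?sqrtr_ge0//.
rewrite rkhs_normE//.
have cv1 : (fun n => B ^+ 2 + dot (u n - h) (u n - h)) @ \oo --> B ^+ 2 + 0.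
  by apply: cvgD; [exact: cvg_cst|].
rewrite addr0 in cv1; rewrite -(cvg_lim (@Rhausdorff R) cv1); apply: limr_ge.
  by apply/cvg_ex; eexists; exact: cv1.
near=> n.
have Sun : S (u n) by exact: Sc.
rewrite rkhs_dot_sqrB// [dot (u n) h]rkhs_dotC// /u (rkhs_dot_comb _ Sh) hf.
have := JB (s n); rewrite /J /L; lra.
Unshelve. all: by end_near.
Qed.

End rkhs_theory.

(** If [g] is a combination of the sections of [k1], then evaluation of [f]
   against its weights is the inner product of [f] and [g], hence bounded by
   the norm of [f] times the Gram sum of [k1], which is at most [c] times that
   of [k2]. *)
Lemma embedding_of_kernel_le (R : realType) (X : Type) (k1 k2 : X -> X -> R)
    (H1 : rkhs k1) (H2 : rkhs k2) (c : R) (f : X -> R^o) : 0 <= c ->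
  kernel_le k1 (fun x y => c * k2 x y) -> rkhs_set H1 f ->
  rkhs_set H2 f /\ rkhs_norm H2 f <= Num.sqrt c * rkhs_norm H1 f.
Proof.
move=> c0 /kernel_leP hk Sf; apply: rkhs_mem_of_bound => [|s].
  by rewrite mulr_ge0 ?sqrtr_ge0.
rewrite -(rkhs_dot_comb s Sf); apply: le_trans (rkhs_cauchy_schwarz Sf (rkhs_set_comb H1 s)) _.
rewrite exprMn sqr_sqrtr// rkhs_normE// rkhs_gram [c * _]mulrC -mulrA.
by rewrite ler_wpM2l ?rkhs_dot_ge0// -gramZ.
Qed.

(** The combination f of sections of [k1] and the combination g of sections of
   [k2] with the same weights satisfy |f|_1^2 = <f, g>_2 <= |f|_2 |g|_2
   <= K |f|_1 |g|_2, so that |f|_1 <= K |g|_2. *)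
Lemma kernel_le_of_embedding (R : realType) (X : Type) (k1 k2 : X -> X -> R)
    (H1 : rkhs k1) (H2 : rkhs k2) : continuously_embedded H1 H2 ->
  exists K : R, kernel_le k1 (fun x y => K * k2 x y).
Proof.
move=> [sub [K K0 hK]]; exists (K ^+ 2); apply/kernel_leP => s; rewrite gramZ.
have S1 := rkhs_set_comb H1 s; have S2 := sub _ S1.
have := rkhs_cauchy_schwarz S2 (rkhs_set_comb H2 s).
rewrite rkhs_dot_comb// -(rkhs_dot_comb s S1) !rkhs_gram.
have : rkhs_dot H2 (comb k1 s) (comb k1 s) <= K ^+ 2 * gram k1 s.
  rewrite -(rkhs_gram H1) -!rkhs_normE// -exprMn ler_pXn2r ?nnegrE ?sqrtr_ge0//.
    exact: hK.
  by rewrite mulr_ge0 ?sqrtr_ge0// ltW.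
have := rkhs_dot_ge0 (rkhs_set_comb H2 s); rewrite rkhs_gram.
have := rkhs_dot_ge0 S1; rewrite rkhs_gram.
set G1 := gram _ _; set G2 := gram _ _; set D := rkhs_dot _ _ _ => G10 G20 DG h.
have [->|G1n0] := eqVneq G1 0; first by rewrite mulr_ge0 ?sqr_ge0.
rewrite -(ler_pM2l (_ : 0 < G1)) ?lt_def ?G1n0// -expr2.
apply: le_trans h _; rewrite mulrA [G1 * _]mulrC; exact: ler_wpM2r.
Qed.

(** * Positive semidefinite matrices *)

Definition bil (R : realType) (d : nat) (M : 'M[R]_d) (x y : 'cV[R]_d) : R :=
  (x^T *m M *m y) 0 0.

Section bil_theory.
Context (R : realType) (d : nat).
Implicit Types (M N A P Q : 'M[R]_d) (x y z u w : 'cV[R]_d).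

Lemma bilDr M x y z : bil M x (y + z) = bil M x y + bil M x z.
Proof. by rewrite /bil mulmxDr mxE. Qed.

Lemma bilZr M a x y : bil M x (a *: y) = a * bil M x y.
Proof. by rewrite /bil -scalemxAr mxE. Qed.

Lemma bilNr M x y : bil M x (- y) = - bil M x y.
Proof. by rewrite /bil mulmxN mxE. Qed.

Lemma bilDl M x y z : bil M (y + z) x = bil M y x + bil M z x.
Proof. by rewrite /bil linearD /= !mulmxDl mxE. Qed.

Lemma bilZl M a x y : bil M (a *: y) x = a * bil M y x.
Proof. by rewrite /bil linearZ /= -!scalemxAl mxE. Qed.

Lemma bilNl M x y : bil M (- y) x = - bil M y x.
Proof. by rewrite /bil linearN /= !mulNmx mxE. Qed.

Lemma bilDm M N x y : bil (M + N) x y = bil M x y + bil N x y.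
Proof. by rewrite /bil mulmxDr mulmxDl mxE. Qed.

Lemma bilZm a M x y : bil (a *: M) x y = a * bil M x y.
Proof. by rewrite /bil -scalemxAr -scalemxAl mxE. Qed.

Lemma bilNm M x y : bil (- M) x y = - bil M x y.
Proof. by rewrite /bil mulmxN mulNmx mxE. Qed.

Lemma bilC M x y : M^T = M -> bil M x y = bil M y x.
Proof.
move=> hM; rewrite /bil; transitivity ((x^T *m M *m y)^T 0 0); first by rewrite [RHS]mxE.
by rewrite !trmx_mul trmxK hM mulmxA.
Qed.

Lemma bil_comm1 u x : (x^T *m u) 0 0 = (u^T *m x) 0 0.
Proof.
by transitivity ((x^T *m u)^T 0 0); [rewrite [RHS]mxE|rewrite trmx_mul trmxK].
Qed.

Lemma bil_rank1 u x y : bil (u *m u^T) x y = (x^T *m u) 0 0 * (u^T *m y) 0 0.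
Proof. by rewrite /bil mulmxA -mulmxA mxE big_ord1. Qed.

Lemma bil_delta M i j : bil M (delta_mx i 0) (delta_mx j 0) = M i j.
Proof. by rewrite /bil trmx_delta -rowE -colE !mxE. Qed.

Lemma bil_sqrB M x y : M^T = M ->
  bil M (x - y) (x - y) = bil M x x - 2 * bil M x y + bil M y y.
Proof. by move=> hM; rewrite !(bilDl, bilDr, bilNl, bilNr) (bilC y x hM); ring. Qed.

Lemma spd_psd A : spdmx A -> psdmx A.
Proof.
move=> [hA hx]; split=> // x; have [->|x0] := eqVneq x 0; last by rewrite ltW// hx.
by rewrite mulmx0 mxE.
Qed.

Lemma psd_cauchy_schwarz M x y : psdmx M ->
  bil M x y ^+ 2 <= bil M x x * bil M y y.
Proof.
move=> [hM M0]; apply: discriminant_le0 => [|t]; first exact: M0.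
have := M0 (x + t *: y); rewrite -/(bil _ _ _).
by rewrite !(bilDl, bilDr, bilZl, bilZr) (bilC y x hM); lra.
Qed.

(** One step of symmetric Gaussian elimination.  If the pivot vanishes, then so
   does [w], because 0^-1 = 0; this is consistent with the formula, as the row of
   a vanishing diagonal entry is zero. *)
Lemma psd_pivot M (k : 'I_d) : psdmx M ->
  let w := (Num.sqrt (M k k))^-1 *: col k M in
  psdmx (M - w *m w^T) /\
  forall i j, (M - w *m w^T) i j = M i j - M i k * M j k / M k k.
Proof.
move=> hM w; have [sM M0] := hM.
have Mkk : 0 <= M k k by rewrite -bil_delta; exact: M0.
have hw i j : (w *m w^T) i j = M i k * M j k / M k k.
  rewrite !mxE big_ord1 !mxE mulrACA -invfM -expr2 sqr_sqrtr// mulrC.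
  by [].
have sy i j : M i j = M j i by rewrite -[in LHS]sM mxE.
split; last by move=> i j; rewrite !mxE -hw mxE.
split; first by rewrite linearB /= sM trmx_mul trmxK.
move=> x; rewrite -/(bil _ _ _) bilDm bilNm subr_ge0 bil_rank1.
have -> : (x^T *m w) 0 0 = (Num.sqrt (M k k))^-1 * bil M x (delta_mx k 0).
  by rewrite /w -scalemxAr [LHS]mxE colE /bil mulmxA.
have -> : (w^T *m x) 0 0 = (Num.sqrt (M k k))^-1 * bil M x (delta_mx k 0).
  by rewrite bilC// /w linearZ /= -scalemxAl [LHS]mxE colE /bil trmx_mul sM.
rewrite mulrACA -invfM -!expr2 sqr_sqrtr//.
have := psd_cauchy_schwarz x (delta_mx k 0) hM; rewrite bil_delta.
have [->|Mkk0] := eqVneq (M k k) 0; first by rewrite invr0 mul0r => _; exact: M0.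
by move=> h; rewrite mulrC ler_pdivrMr// lt_def Mkk0.
Qed.

(** Eliminate the rows one after the other; a row that has been cleared stays
   zero in the later steps. *)
Lemma psd_sum_rank1 M : psdmx M ->
  exists w : 'I_d -> 'cV[R]_d, M = \sum_i w i *m (w i)^T.
Proof.
move=> hM.
suff elim n : (n <= d)%N -> exists w : nat -> 'cV[R]_d,
    psdmx (M - \sum_(i < n) w i *m (w i)^T) /\
    forall i j : 'I_d, (i < n)%N -> (M - \sum_(i < n) w i *m (w i)^T) i j = 0.
  have [w [_ h]] := elim d (leqnn d); exists (fun i => w i).
  apply/eqP; rewrite -subr_eq0; apply/eqP/matrixP => i j.
  by rewrite h// mxE.
elim: n => [_|n IH nd].
  by exists (fun=> 0); rewrite big_ord0 subr0; split.
have [w []] := IH (ltnW nd).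
set N := M - _ => hN N0.
have [pN eN] := psd_pivot (Ordinal nd) hN.
set v := _ *: _ in pN eN.
exists (fun m => if (m < n)%N then w m else v).
have -> : M - \sum_(i < n.+1) (if (i < n)%N then w i else v) *m
      (if (i < n)%N then w i else v)^T = N - v *m v^T.
  rewrite big_ord_recr /= ltnn opprD addrA; congr (_ - _ - _).
  by apply: eq_bigr => i _; rewrite ltn_ord.
split=> // i j; rewrite ltnS leq_eqVlt eN => /orP[/eqP ie|ilt]; last first.
  by rewrite !(N0 i _ ilt) !mul0r subr0.
have -> : i = Ordinal nd by apply: val_inj.
set k := Ordinal nd.
have sN : N j k = N k j by case: hN => sN _; rewrite -[in LHS]sN mxE.
have [Nk0|Nk0] := eqVneq (N k k) 0; last by rewrite sN; field.
(* a vanishing pivot: the rest of its row vanishes by Cauchy-Schwarz *)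
have := psd_cauchy_schwarz (delta_mx k 0) (delta_mx j 0) hN.
rewrite !bil_delta Nk0 mul0r => h.
have /eqP -> : N k j == 0 by rewrite -sqrf_eq0 eq_le h sqr_ge0.
by rewrite !mul0r subr0.
Qed.

Lemma spd_unit A : spdmx A -> A \in unitmx.
Proof.
move=> [_ hA]; rewrite unitmxE unitfE; apply/negP => /eqP/eqP/det0P[v v0 vA].
have := hA v^T; rewrite trmxK vA mul0mx mxE ltxx.
by have -> : v^T != 0 by [rewrite trmx_eq0]; move/(_ isT).
Qed.

Lemma spd_det_gt0 A : spdmx A -> 0 < \det A.
Proof.
move=> hA; rewrite lt_def -unitfE -unitmxE spd_unit//=.
have [w ->] := psd_sum_rank1 (spd_psd hA).
pose W : 'M[R]_d := \matrix_(i, j) w j i 0.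
have -> : \sum_i w i *m (w i)^T = W *m W^T.
  apply/matrixP => i j; rewrite summxE mxE; apply: eq_bigr => l _.
  by rewrite !mxE big_ord1 mxE.
by rewrite det_mulmx det_tr -expr2 sqr_ge0.
Qed.

Lemma invmx_eq A (B : 'M[R]_d) : A *m B = 1%:M -> invmx A = B.
Proof.
move=> h; have [uA _] := mulmx1_unit h.
by rewrite -[invmx A]mulmx1 -h mulKmx.
Qed.

Lemma spd_inv A : spdmx A -> spdmx (invmx A).
Proof.
move=> hA; have uA := spd_unit hA; have [sA pA] := hA.
have si : (invmx A)^T = invmx A by rewrite trmx_inv sA.
split=> // x x0.
have -> : invmx A = (invmx A)^T *m A *m invmx A by rewrite si mulVmx// mul1mx.
have -> : x^T *m ((invmx A)^T *m A *m invmx A) *m x =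
    (invmx A *m x)^T *m A *m (invmx A *m x) by rewrite trmx_mul !mulmxA.
apply: pA; apply: contraNneq x0 => h.
by rewrite -[x](mulKVmx uA) h mulmx0.
Qed.

Lemma spd_sqr A : spdmx A -> spdmx (A ^+ 2).
Proof.
move=> hA; have [sA _] := hA; have uA := spd_unit hA; rewrite expr2.
split; first by rewrite -mulmxE trmx_mul sA.
move=> x x0; rewrite -mulmxE -[X in X *m A]sA mulmxA -trmx_mul -mulmxA mxE.
have : A *m x != 0 by apply: contraNneq x0 => h; rewrite -[x](mulKmx uA) h mulmx0.
set y := A *m x => y0.
under eq_bigr do rewrite mxE -expr2.
rewrite lt_def sumr_ge0 ?andbT => [|i _]; last exact: sqr_ge0.
apply: contraNneq y0 => /psumr_eq0P h; apply/eqP/matrixP => i j; rewrite (ord1 j) [RHS]mxE.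
by apply/eqP; rewrite -sqrf_eq0 h// => l _; exact: sqr_ge0.
Qed.

Lemma invmx_sqr A : A \in unitmx -> invmx (A ^+ 2) = invmx A ^+ 2.
Proof.
by move=> uA; apply: invmx_eq; rewrite !expr2 -!mulmxE mulmxA mulmxK// mulmxV.
Qed.

(** The Sherman-Morrison formula. *)
Lemma invmx_rank1 A w : spdmx A -> let u := invmx A *m w in
  invmx (A + w *m w^T) = invmx A - (1 + bil (invmx A) w w)^-1 *: (u *m u^T).
Proof.
move=> hA u; have uA := spd_unit hA; have [si _] := spd_inv hA.
have q0 : 0 <= bil (invmx A) w w by case: (spd_psd (spd_inv hA)) => _; apply.
apply: invmx_eq.
have e1 : A *m (u *m u^T) = w *m u^T by rewrite mulmxA mulKVmx.
have e2 : w *m w^T *m invmx A = w *m u^T by rewrite trmx_mul si mulmxA.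
have e3 : w *m w^T *m (u *m u^T) = bil (invmx A) w w *: (w *m u^T).
  rewrite -mulmxA [w^T *m _]mulmxA.
  have -> : w^T *m u = (bil (invmx A) w w)%:M.
    by rewrite [LHS]mx11_scalar /bil /u mulmxA.
  by rewrite mul_scalar_mx scalemxAr.
rewrite mulmxBr !mulmxDl -!scalemxAr mulmxV// e1 e2 e3 scalerA.
set q := bil _ _ _ in q0 *; rewrite -scalerDl -[X in X + _ * q]mulr1 -mulrDr.
by rewrite mulVf ?scale1r ?addrK// gt_eqF// ltr_wpDr.
Qed.

(** Two block factorisations of the matrix with rows (1, - v) and (u, 1). *)
Lemma det_1_rank1 (u : 'cV[R]_d) (v : 'rV[R]_d) :
  \det (1%:M + u *m v) = 1 + (v *m u) 0 0.
Proof.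
have : block_mx 1%:M 0 u 1%:M *m block_mx 1%:M (- v) 0 (1%:M + u *m v) =
       block_mx (1%:M + v *m u) (- v) 0 1%:M *m block_mx 1%:M 0 u 1%:M.
  rewrite !mulmx_block !(mul1mx, mulmx1, mul0mx, mulmx0, addr0, add0r).
  by rewrite mulmxN mulNmx addrK addrCA addNr addr0.
move/(congr1 determinant); rewrite !det_mulmx !det_lblock !det_ublock !det1.
by rewrite !(mul1r, mulr1) => ->; rewrite det_mx11 !mxE.
Qed.

Lemma det_rank1 A w : spdmx A ->
  \det (A + w *m w^T) = \det A * (1 + bil (invmx A) w w).
Proof.
move=> hA; have uA := spd_unit hA.
have -> : A + w *m w^T = A *m (1%:M + (invmx A *m w) *m w^T).
  by rewrite mulmxDr mulmx1 mulmxA mulKVmx.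
by rewrite det_mulmx det_1_rank1 /bil mulmxA.
Qed.

Lemma spd_rank1 A w : spdmx A -> spdmx (A + w *m w^T).
Proof.
move=> [sA pA]; split; first by rewrite linearD /= sA trmx_mul trmxK.
move=> x x0; rewrite -/(bil _ _ _) bilDm bil_rank1.
by rewrite bil_comm1 ltr_wpDr// ?pA// -expr2 sqr_ge0.
Qed.

(** Write y = Q^-1 x.  Expanding
   0 <= (P^-1 x - y)^T P (P^-1 x - y) = x^T P^-1 x - 2 x^T y + y^T P y
   and using y^T P y <= y^T Q y = x^T y gives the claim. *)
Lemma spd_inv_antitone P Q : spdmx P -> spdmx Q ->
  (forall x, bil P x x <= bil Q x x) -> loewner_ge (invmx P) (invmx Q).
Proof.
move=> hP hQ PQ; have [sP _] := spd_inv hP; have [sQ _] := spd_inv hQ.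
split; first by rewrite linearB /= sP sQ.
move=> x; rewrite -/(bil _ _ _) bilDm bilNm.
set y := invmx Q *m x.
have eQ : bil Q y y = bil (invmx Q) x x.
  by rewrite /bil /y trmx_mul sQ !mulmxA mulmxKV ?spd_unit.
have eP : bil P (invmx P *m x) (invmx P *m x) = bil (invmx P) x x.
  by rewrite /bil trmx_mul sP !mulmxA mulmxKV ?spd_unit.
have ePy : bil P (invmx P *m x) y = bil (invmx Q) x x.
  by rewrite /bil /y trmx_mul sP !mulmxA mulmxKV ?spd_unit.
have [sP' P0] := spd_psd hP.
have := P0 (invmx P *m x - y); rewrite -/(bil _ _ _) bil_sqrB// eP ePy.
by have := PQ y; rewrite eQ; lra.
Qed.

End bil_theory.
(** * Gaussian kernels on a Euclidean space *)

Definition gauss (R : realType) (d : nat) (M : 'M[R]_d) (x y : 'cV[R]_d) : R :=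
  expR (- bil M (x - y) (x - y)).

Section gauss_theory.
Context (R : realType) (d : nat).
Implicit Types (M A P : 'M[R]_d) (x y u w : 'cV[R]_d) (s : seq (R * 'cV[R]_d)).

(** The factors exp (- x^T M x) and exp (- y^T M y) go into the weights; there
   remains exp (2 x^T M y), and a decomposition of [M] into matrices of rank
   one displays the features of 2 x^T M y. *)
Lemma gauss_gram_ge0 M s : psdmx M -> 0 <= gram (gauss M) s.
Proof.
move=> hM; have [w Mw] := psd_sum_rank1 hM; have [sM _] := hM.
pose c (p : R * 'cV[R]_d) := p.1 * expR (- bil M p.2 p.2).
pose f l (p : R * 'cV[R]_d) := Num.sqrt 2 * ((w l)^T *m p.2) 0 0.
have := psd_expR s f c; congr (0 <= _).
apply: eq_bigr => p _; apply: eq_bigr => q _.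
have -> : \sum_l f l p * f l q = 2 * bil M p.2 q.2.
  rewrite bilC// [in RHS]Mw /bil mulmx_sumr mulmx_suml summxE mulr_sumr.
  apply: eq_bigr => l _; rewrite -/(bil _ _ _) bil_rank1 bil_comm1.
  by rewrite /f mulrACA -expr2 sqr_sqrtr// [X in _ * X]mulrC.
rewrite /c /gauss bil_sqrB// !opprD opprK !expRD; ring.
Qed.

Lemma expR_second_order (B D t : R) (Y : R := 2 * `|B| + `|D|) : 0 < t -> t <= 1 ->
  `|expR (- (2 * t * B) - t ^+ 2 * D) - (1 - 2 * t * B + t ^+ 2 * (2 * B ^+ 2 - D))|
   <= (expR Y * Y ^+ 3 + Y ^+ 2) * t ^+ 3.
Proof.
move=> t0 t1.
have Y0 : 0 <= Y by rewrite addr_ge0 ?mulr_ge0.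
set z := - (2 * t * B) - t ^+ 2 * D.
have zY : `|z| <= t * Y.
  have -> : z = t * (- (2 * B) - t * D) by rewrite /z; ring.
  rewrite normrM (gtr0_norm t0) ler_wpM2l ?(ltW t0)//.
  apply: le_trans (ler_normB _ _) _; rewrite normrN !normrM (gtr0_norm t0) normr_nat.
  by rewrite lerD2l ler_piMl.
(* what z ^+ 2 / 2 contributes beyond order 2 in t goes into the remainder *)
have := expR_taylor 3 z.
rewrite !big_ord_recr big_ord0 /= add0r expr0 expr1 !fact0 !factS fact0.
have -> : expR z - (z ^+ 0 / 1%:R + z / (1 * 1)%:R + z ^+ 2 / (2 * (1 * 1))%:R) =
  (expR z - (1 - 2 * t * B + t ^+ 2 * (2 * B ^+ 2 - D))) - t ^+ 3 * (2 * B * D + t * D ^+ 2 / 2).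
  by rewrite /z; field.
set a := expR z - _ => ha.
have h2 : `|t ^+ 3 * (2 * B * D + t * D ^+ 2 / 2)| <= Y ^+ 2 * t ^+ 3.
  rewrite normrM ger0_norm ?exprn_ge0 ?(ltW t0)// mulrC ler_wpM2r ?exprn_ge0 ?(ltW t0)//.
  apply: le_trans (ler_normD _ _) _; rewrite !normrM normfV !normr_nat (gtr0_norm t0).
  have : t * `|D| ^+ 2 <= `|D| ^+ 2 by rewrite ler_piMl ?sqr_ge0.
  have := normr_ge0 B; have := normr_ge0 D; rewrite /Y.
  move: `|B| `|D| => b e e0 b0 ?; have := mulr_ge0 b0 e0; have := sqr_ge0 b; have := sqr_ge0 e; lra.
have h3 : expR `|z| * `|z| ^+ 3 <= expR Y * Y ^+ 3 * t ^+ 3.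
  rewrite -mulrA -exprMn [Y * t]mulrC; apply: ler_pM; rewrite ?expR_ge0 ?exprn_ge0//.
    by rewrite ler_expR (le_trans zY)// ler_piMl.
  by rewrite lerXn2r ?nnegrE ?mulr_ge0 ?(ltW t0).
rewrite -[a](subrK (t ^+ 3 * (2 * B * D + t * D ^+ 2 / 2))).
apply: le_trans (ler_normD _ _) _; rewrite [leRHS]mulrDl.
by apply: lerD => //; apply: le_trans ha h3.
Qed.

Definition pairs (T : Type) (s : seq T) := [seq (p, q) | p <- s, q <- s].

Lemma sum_pairs (T : Type) (s : seq T) (F : T -> T -> R) :
  \sum_(p <- s) \sum_(q <- s) F p q = \sum_(z <- pairs s) F z.1 z.2.
Proof. by rewrite /pairs big_allpairs_dep. Qed.

(** Positive definiteness on the points x_i and x_i + w, with weights - a_i and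
   a_i: the two mixed terms agree because the kernel is even. *)
Lemma gauss_gram_shift M w s : psdmx M ->
  \sum_(p <- s) \sum_(q <- s) p.1 * q.1 * gauss M (p.2 + w) q.2 <= gram (gauss M) s.
Proof.
move=> hM; have [sM _] := hM.
have := gauss_gram_ge0 ([seq (- p.1, p.2) | p <- s] ++ [seq (p.1, p.2 + w) | p <- s]) hM.
rewrite /gram big_cat !big_map /=.
under eq_bigr do rewrite big_cat !big_map /=.
under [X in _ + X]eq_bigr do rewrite big_cat !big_map /=.
rewrite !big_split /=.
set G := (X in _ -> _ <= X); set S := (X in _ -> X <= _).
have -> : \sum_(p <- s) \sum_(q <- s) - p.1 * - q.1 * gauss M p.2 q.2 = G.
  by apply: eq_bigr => p _; apply: eq_bigr => q _; rewrite mulrNN.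
have -> : \sum_(p <- s) \sum_(q <- s) - p.1 * q.1 * gauss M p.2 (q.2 + w) = - S.
  rewrite exchange_big /= -sumrN; apply: eq_bigr => p _.
  rewrite -sumrN; apply: eq_bigr => q _; rewrite !mulNr [q.1 * _]mulrC.
  by congr (- (_ * expR (- _))); rewrite -opprB bilNl bilNr opprK.
have -> : \sum_(p <- s) \sum_(q <- s) p.1 * - q.1 * gauss M (p.2 + w) q.2 = - S.
  rewrite -sumrN; apply: eq_bigr => p _; rewrite -sumrN; apply: eq_bigr => q _.
  by rewrite mulrN mulNr.
have -> : \sum_(p <- s) \sum_(q <- s) p.1 * q.1 * gauss M (p.2 + w) (q.2 + w) = G.
  apply: eq_bigr => p _; apply: eq_bigr => q _; congr (_ * expR (- _)).
  by rewrite opprD addrACA subrr addr0.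
lra.
Qed.

(** By [gauss_gram_shift], the sum with weights a_i a_j of
   exp (- z^T M z), z = x_i - x_j + t w, is maximal at t = 0; the inequality
   says that its second derivative there is not positive.  The term of first
   order vanishes since it is antisymmetric in i and j. *)
Lemma gauss_second_derivative M w s : psdmx M ->
  2 * (\sum_(p <- s) \sum_(q <- s) p.1 * q.1 *
         (bil M w (p.2 - q.2) ^+ 2 * gauss M p.2 q.2))
  <= bil M w w * gram (gauss M) s.
Proof.
move=> hM; have [sM _] := hM.
pose c (z : (R * 'cV[R]_d) * (R * 'cV[R]_d)) := z.1.1 * z.2.1 * gauss M z.1.2 z.2.2.
pose B (z : (R * 'cV[R]_d) * (R * 'cV[R]_d)) := bil M w (z.1.2 - z.2.2).
set D := bil M w w.
have -> : \sum_(p <- s) \sum_(q <- s) p.1 * q.1 * (bil M w (p.2 - q.2) ^+ 2 * gauss M p.2 q.2)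
   = \sum_(z <- pairs s) c z * B z ^+ 2.
  by rewrite sum_pairs; apply: eq_bigr => z _; rewrite /c /B; ring.
have -> : gram (gauss M) s = \sum_(z <- pairs s) c z by rewrite /gram sum_pairs.
rewrite -subr_le0.
pose Y z := 2 * `|B z| + `|D|.
apply: (@le0_of_le_linear _ _
  (\sum_(z <- pairs s) `|c z| * (expR (Y z) * Y z ^+ 3 + Y z ^+ 2))) => t t0 t1.
have cB : \sum_(z <- pairs s) c z * B z = 0.
  transitivity (\sum_(p <- s) \sum_(q <- s) c (p, q) * B (p, q)).
    by rewrite sum_pairs; apply: eq_bigr => -[].
  set T := LHS.
  suff : T = - T by lra.
  rewrite {1}/T exchange_big /= /T -sumrN; apply: eq_bigr => p _.
  rewrite -sumrN; apply: eq_bigr => q _; rewrite /c /B /= -mulrN -bilNr opprB.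
  rewrite [q.1 * p.1]mulrC; congr (_ * expR (- _) * _).
  by rewrite -opprB bilNl bilNr opprK.
have hs : \sum_(z <- pairs s) c z * (expR (- (2 * t * B z) - t ^+ 2 * D) - 1) <= 0.
  have := gauss_gram_shift (t *: w) s hM.
  rewrite /gram !sum_pairs -subr_le0 -sumrB; congr (_ <= 0).
  apply: eq_bigr => z _; rewrite mulrBr mulr1; congr (_ - _).
  rewrite /c -[RHS]mulrA /gauss -expRD; congr (_ * expR _).
  rewrite addrAC /B; move: (z.1.2 - z.2.2) => v.
  by rewrite !(bilDl, bilDr, bilZl, bilZr) (bilC v w sM) -/D; ring.
(* the first order term may be added freely, as it vanishes *)
have key : \sum_(z <- pairs s) c z * (expR (- (2 * t * B z) - t ^+ 2 * D) - 1) -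
  t ^+ 2 * (2 * (\sum_(z <- pairs s) c z * B z ^+ 2) - D * \sum_(z <- pairs s) c z) =
  \sum_(z <- pairs s) c z * (expR (- (2 * t * B z) - t ^+ 2 * D) -
     (1 - 2 * t * B z + t ^+ 2 * (2 * B z ^+ 2 - D))).
  transitivity (\sum_(z <- pairs s) c z * (expR (- (2 * t * B z) - t ^+ 2 * D) - 1) -
    t ^+ 2 * (2 * (\sum_(z <- pairs s) c z * B z ^+ 2) - D * \sum_(z <- pairs s) c z)
    + 2 * t * \sum_(z <- pairs s) c z * B z); first by rewrite cB mulr0 addr0.
  rewrite !mulr_sumr -sumrB mulr_sumr -sumrB -big_split /=.
  by apply: eq_bigr => z _; ring.
have bound : `|\sum_(z <- pairs s) c z * (expR (- (2 * t * B z) - t ^+ 2 * D) -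
     (1 - 2 * t * B z + t ^+ 2 * (2 * B z ^+ 2 - D)))| <=
   (\sum_(z <- pairs s) `|c z| * (expR (Y z) * Y z ^+ 3 + Y z ^+ 2)) * t ^+ 3.
  apply: le_trans (ler_norm_sum _ _ _) _; rewrite mulr_suml; apply: ler_sum => z _.
  by rewrite normrM -[leRHS]mulrA ler_wpM2l// expR_second_order.
move: bound; rewrite -key ler_norml => /andP[bound _].
rewrite -(ler_pM2l (_ : 0 < t ^+ 2)) ?exprn_gt0//.
set M3 := \sum_(z <- _) `|_| * _ in bound *.
rewrite mulrCA -exprSr; lra.
Qed.

End gauss_theory.
Lemma is_derive_sum_expR (R : realType) (I : Type) (r : seq I) (c a b : I -> R) (t : R) :
  is_derive t 1 (fun t => \sum_(i <- r) c i * expR (a i + t * b i))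
    (\sum_(i <- r) c i * (b i * expR (a i + t * b i))).
Proof.
elim: r => [|i r IH].
  by rewrite big_nil; under eq_fun do rewrite big_nil; exact: is_derive_cst.
rewrite big_cons; under eq_fun do rewrite big_cons.
have di : is_derive t 1 (fun t => c i * expR (a i + t * b i))
    (c i * (b i * expR (a i + t * b i))).
  have -> : (fun t => c i * expR (a i + t * b i)) =
    c i \*: ((expR : R -> R) \o (fun t => a i + t * b i)) by [].
  apply: is_derive_eq.
  by rewrite /GRing.scale /=; ring.
exact: is_deriveD.
Qed.

(** * Monotonicity of the normalised Gaussian kernels *)

Section gauss_monotone.
Context (R : realType) (d : nat).
Implicit Types (M A P : 'M[R]_d) (x y u w : 'cV[R]_d) (s : seq (R * 'cV[R]_d)).

Lemma bil_downdate P w (t : R) x y : P^T = P ->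
  bil (P - t *: ((P *m w) *m (P *m w)^T)) x y =
  bil P x y - t * (bil P w x * bil P w y).
Proof.
move=> sP; rewrite bilDm bilNm bilZm bil_rank1 bil_comm1.
by rewrite trmx_mul sP.
Qed.

Lemma psd_downdate P w (t : R) : psdmx P -> 0 <= t -> t * bil P w w <= 1 ->
  psdmx (P - t *: ((P *m w) *m (P *m w)^T)).
Proof.
move=> hP t0 tq; have [sP P0] := hP; split.
  by rewrite linearB /= linearZ /= sP trmx_mul trmxK.
move=> x; rewrite -/(bil _ _ _) bil_downdate// subr_ge0 -expr2.
apply: le_trans (_ : t * (bil P w w * bil P x x) <= _).
  by rewrite ler_wpM2l// psd_cauchy_schwarz.
by rewrite mulrA -[leRHS]mul1r ler_wpM2r//; exact: P0.
Qed.

(** Along P_t = P - t u u^T, [gauss_second_derivative] in the direction [w]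
   becomes 2 (1 - t q) T' <= q T after division by 1 - t q, and this says that
   (1 - t q) T^2 has a nonpositive derivative.  Squaring T avoids a square root
   of 1 - t q. *)
Lemma gauss_gram_downdate P w s (q : R := bil P w w) : psdmx P ->
  gram (gauss (P - (1 + q)^-1 *: ((P *m w) *m (P *m w)^T))) s <=
  Num.sqrt (1 + q) * gram (gauss P) s.
Proof.
move=> hP; have [sP P0] := hP.
have q0 : 0 <= q by exact: P0.
pose Pt t := P - t *: ((P *m w) *m (P *m w)^T).
pose c (z : (R * 'cV[R]_d) * (R * 'cV[R]_d)) := z.1.1 * z.2.1.
pose a (z : (R * 'cV[R]_d) * (R * 'cV[R]_d)) := - bil P (z.1.2 - z.2.2) (z.1.2 - z.2.2).
pose b (z : (R * 'cV[R]_d) * (R * 'cV[R]_d)) := bil P w (z.1.2 - z.2.2) ^+ 2.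
pose T (t : R) : R := \sum_(z <- pairs s) c z * expR (a z + t * b z).
pose T' (t : R) : R := \sum_(z <- pairs s) c z * (b z * expR (a z + t * b z)).
have gE t z : gauss (Pt t) z.1.2 z.2.2 = expR (a z + t * b z).
  by rewrite /gauss bil_downdate// opprB addrC /a /b expr2.
have TE t : gram (gauss (Pt t)) s = T t.
  by rewrite /gram sum_pairs; apply: eq_bigr => z _; rewrite gE.
set s1 := (1 + q)^-1.
have q1 : 0 < 1 + q by rewrite ltr_wpDr.
have s1_gt0 : 0 < s1 by rewrite invr_gt0.
have s1q : 1 - s1 * q = s1 by rewrite /s1; field; rewrite gt_eqF.
pose f (t : R) : R := (1 - t * q) * (T t) ^+ 2.
pose f' (t : R) : R := - q * (T t) ^+ 2 + (1 - t * q) * (2 * (T t * T' t)).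
have df (t : R) : is_derive t 1 f (f' t).
  have dT := is_derive_sum_expR (pairs s) c a b t : is_derive t (1 : R) (T : R -> R) (T' t).
  have -> : f = (fun t : R => 1 - t * q) \* (T \* T) by apply/funext => e; rewrite /f expr2.
  apply: is_derive_eq.
  by rewrite /GRing.scale /= /f'; ring.
have f'_le0 t : 0 < t -> t < s1 -> f' t <= 0.
  move=> t0 ts.
  have tq1 : 0 < 1 - t * q.
    have : t * q <= s1 * q by rewrite ler_wpM2r// ltW.
    lra.
  have psdt : psdmx (Pt t) by apply: psd_downdate => //; [exact: ltW|rewrite -/q; lra].
  have := gauss_second_derivative w s psdt.
  rewrite TE bil_downdate// -/q.
  have -> : \sum_(p <- s) \sum_(q <- s) p.1 * q.1 *
      (bil (Pt t) w (p.2 - q.2) ^+ 2 * gauss (Pt t) p.2 q.2) = (1 - t * q) ^+ 2 * T' t.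
    rewrite sum_pairs /T' mulr_sumr; apply: eq_bigr => z _.
    by rewrite gE bil_downdate// -/q /c /b; ring.
  have T0 : 0 <= T t by rewrite -TE gauss_gram_ge0.
  rewrite (_ : q - t * (q * q) = (1 - t * q) * q); last by ring.
  rewrite expr2 -!mulrA mulrCA ler_pM2l// => h.
  have : T t * (2 * ((1 - t * q) * T' t) - q * T t) <= 0.
    by rewrite mulr_ge0_le0// subr_le0.
  rewrite /f'; lra.
have fle : f s1 <= f 0.
  have fd (e : R) : derivable f e 1 by apply: ex_derive; exact: df.
  apply: (@ler0_derive1_le_cc _ f 0 s1) => //.
  - move=> e; rewrite in_itv /= => /andP[e0 es]; have de := df e.
    by rewrite derive1E derive_val f'_le0.
  - by apply: continuous_subspaceT => e; apply/differentiable_continuous/derivable1_diffP.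
  - by rewrite in_itv /= lexx ltW.
  - by rewrite in_itv /= lexx ltW.
  - exact: ltW.
rewrite TE.
have T0 : gram (gauss P) s = T 0 by rewrite -TE /Pt scale0r subr0.
have T00 : 0 <= T 0 by rewrite -T0 gauss_gram_ge0.
rewrite T0.
have [Tn|Tp] := ltP (T s1) 0.
  by rewrite (le_trans (ltW Tn))// mulr_ge0 ?sqrtr_ge0.
rewrite -(ler_pXn2r (isT : (0 < 2)%N)) ?nnegrE ?mulr_ge0 ?sqrtr_ge0//.
rewrite exprMn sqr_sqrtr ?(ltW q1)//.
move: fle; rewrite /f s1q mul0r subr0 mul1r => fle.
by rewrite -ler_pdivrMl.
Qed.

Lemma gauss_gram_rank1 A w s : spdmx A ->
  gram (gauss (invmx (A + w *m w^T))) s <=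
  Num.sqrt (\det (A + w *m w^T) / \det A) * gram (gauss (invmx A)) s.
Proof.
move=> hA; rewrite invmx_rank1// det_rank1// [_ * (1 + _)]mulrC mulfK; last first.
  by rewrite gt_eqF// spd_det_gt0.
exact/gauss_gram_downdate/spd_psd/spd_inv.
Qed.

(** The determinant ratios of the rank one steps multiply up. *)
Lemma gauss_gram_loewner A B s : spdmx A -> spdmx B -> loewner_ge B A ->
  gram (gauss (invmx B)) s <=
  Num.sqrt (\det B / \det A) * gram (gauss (invmx A)) s.
Proof.
move=> hA hB /psd_sum_rank1[w BA].
have {BA} -> : B = A + \sum_(i < d) w i *m (w i)^T by rewrite -BA addrC subrK.
have dA := spd_det_gt0 hA.
suff [//] : spdmx (A + \sum_(i < d) w i *m (w i)^T) /\
  gram (gauss (invmx (A + \sum_(i < d) w i *m (w i)^T))) s <=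
  Num.sqrt (\det (A + \sum_(i < d) w i *m (w i)^T) / \det A) * gram (gauss (invmx A)) s.
elim/big_rec: _ => [|i M _ [hM IH]].
  by rewrite addr0 divff ?gt_eqF// sqrtr1 mul1r.
rewrite [w i *m _ + M]addrC addrA; split; first exact: spd_rank1.
apply: le_trans (gauss_gram_rank1 (w i) s hM) _.
have dM := spd_det_gt0 hM; have dM' := spd_det_gt0 (spd_rank1 (w i) hM).
apply: le_trans (ler_wpM2l (sqrtr_ge0 _) IH) _.
by rewrite mulrA -sqrtrM ?(divr_ge0 (ltW dM') (ltW dM))// mulrA divfK ?gt_eqF.
Qed.

Lemma gauss_kernelE (C : 'M[R]_d) : spdmx C ->
  gauss_kernel C = gauss (invmx (C ^+ 2)).
Proof. by move=> hC; rewrite invmx_sqr// spd_unit. Qed.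

(** Restrict both kernels to the line spanned by [x]. *)
Lemma gauss_kernel_le_line M N (K : R) : psdmx N ->
  kernel_le (gauss M) (fun x y => K * gauss N x y) ->
  forall x, bil M x x <= bil N x x.
Proof.
move=> [_ N0] h x; apply: (@gauss1_kernel_le _ _ _ K) => [|n a t]; first exact: N0.
have E Q (e e' : R) : expR (- (bil Q x x * (e - e') ^+ 2)) = gauss Q (e *: x) (e' *: x).
  by rewrite /gauss -scalerBl bilZl bilZr; congr (expR (- _)); ring.
have := h n a (fun i => t i *: x).
under [X in _ -> X <= _]eq_bigr do under eq_bigr do rewrite E.
by under [X in _ -> _ <= X]eq_bigr do under eq_bigr do rewrite E.
Qed.

End gauss_monotone.

Theorem proposition3p3 (R : realType) (d : nat) (C1 C2 : 'M[R]_d)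
    (hC1 : spdmx C1) (hC2 : spdmx C2)
    (H1 : rkhs (gauss_kernel C1)) (H2 : rkhs (gauss_kernel C2)) :
  (continuously_embedded H1 H2 <-> loewner_ge (C1 ^+ 2) (C2 ^+ 2)) /\
  (loewner_ge (C1 ^+ 2) (C2 ^+ 2) ->
    (forall f, rkhs_set H1 f ->
       rkhs_norm H2 f <= Num.sqrt (\det C1 / \det C2) * rkhs_norm H1 f) /\
    kernel_le (gauss_kernel C1)
      (fun x y => \det C1 / \det C2 * gauss_kernel C2 x y)).
Proof.
have d1 := spd_det_gt0 hC1; have d2 := spd_det_gt0 hC2.
have c0 : 0 < \det C1 / \det C2 by rewrite divr_gt0.
have s1 := spd_sqr hC1; have s2 := spd_sqr hC2.
have dom : loewner_ge (C1 ^+ 2) (C2 ^+ 2) -> kernel_le (gauss_kernel C1)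
      (fun x y => \det C1 / \det C2 * gauss_kernel C2 x y).
  move=> hge; apply/kernel_leP => s; rewrite gramZ !gauss_kernelE//.
  apply: le_trans (gauss_gram_loewner s s2 s1 hge) _.
  have -> : \det (C1 ^+ 2) / \det (C2 ^+ 2) = (\det C1 / \det C2) ^+ 2.
    by rewrite !expr2 -!mulmxE !det_mulmx mulrACA invfM.
  by rewrite sqrtr_sqr gtr0_norm.
have emb (hge : loewner_ge (C1 ^+ 2) (C2 ^+ 2)) f : rkhs_set H1 f -> rkhs_set H2 f /\
    rkhs_norm H2 f <= Num.sqrt (\det C1 / \det C2) * rkhs_norm H1 f.
  by move=> Sf; exact: embedding_of_kernel_le (ltW c0) (dom hge) Sf.
split; last by move=> hge; split; [move=> f /(emb hge)[]|exact: dom].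
split=> [/kernel_le_of_embedding[K]|hge].
  rewrite !gauss_kernelE// => hK.
  have := gauss_kernel_le_line (spd_psd (spd_inv s2)) hK.
  move=> /(spd_inv_antitone (spd_inv s1) (spd_inv s2)).
  by rewrite !invmxK.
split=> [f /(emb hge)[]//|].
exists (Num.sqrt (\det C1 / \det C2)); first by rewrite sqrtr_gt0.
by move=> f /(emb hge)[].
Qed.
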